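(* There is an absolute constant $c>0$ such that for all sufficiently large $n$ and every $p$ with $\frac{3\log^2 n}{n} \le p \le 1-\frac{3\log^2 n}{n}$, the random graph $G=G(n,p)$ satisfies $\mathrm{fun}(G) \ge c\log n$ with probability at least $1-\frac{1}{n^{\log n}}$.
   Context: $\log$ denotes the binary logarithm. $G(n,p)$ is the Erdős–Rényi random graph on $n$ vertices in which each pair of vertices is joined independently with probability $p$. Functionality: let $G=(V,E)$ be a finite simple graph with adjacency matrix $A$. A vertex $v$ is a function of distinct vertices $u_1,\dots,u_k \in V\setminus\{v\}$ if there is a Boolean function $f:\{0,1\}^k\to\{0,1\}$ such that for every vertex $w \in V\setminus\{v,u_1,\dots,u_k\}$ we have $A[v,w] = f(A[w,u_1],\dots,A[w,u_k])$. The functionality $\mathrm{fun}_G(v)$ is the minimum $k$ such that $v$ is a function of some $k$ vertices of $G$. The functionality of $G$ is $\mathrm{fun}(G)=\max_{H}\min_{v\in V(H)} \mathrm{fun}_H(v)$, the maximum taken over all (nonempty) induced subgraphs $H$ of $G$. *)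

(* Defs.v *)
From mathcomp Require Import all_boot all_order all_algebra.
From mathcomp Require Import reals exp.

Set Implicit Arguments.
Unset Strict Implicit.
Unset Printing Implicit Defensive.

Import Order.TTheory GRing.Theory Num.Theory.

Record sgraph := SGraph {
  vertex :> finType;
  adj : rel vertex;
  adj_sym : symmetric adj;
  adj_irrefl : irreflexive adj }.

Section Induced.
Variables (G : sgraph) (S : {set G}).

Definition induced_adj : rel {x : G | x \in S} :=
  fun x y => adj (val x) (val y).

Lemma induced_adj_sym : symmetric induced_adj.
Proof. by move=> x y; rewrite /induced_adj adj_sym. Qed.

Lemma induced_adj_irrefl : irreflexive induced_adj.
Proof. by move=> x; rewrite /induced_adj adj_irrefl. Qed.

Definition induced : sgraph := SGraph induced_adj_sym induced_adj_irrefl.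
End Induced.

Section Functionality.
Variable G : sgraph.

Definition is_function_of (v : G) (k : nat) (u : k.-tuple G) : bool :=
  [&& uniq u, v \notin u &
      [exists f : {ffun k.-tuple bool -> bool}, forall w : G,
         (w \notin v :: u) ==> (adj v w == f [tuple of map (adj w) u])]].

Definition function_of_some (v : G) (k : nat) : bool :=
  [exists u : k.-tuple G, is_function_of v u].

Lemma function_of_others (v : G) : function_of_some v #|G|.-1.
Proof.
have sz : size (enum [set~ v]) == #|G|.-1 by rewrite -cardE cardsC1.
apply/existsP; exists (Tuple sz); apply/and3P; split => /=.
- exact: enum_uniq.
- by rewrite mem_enum !inE eqxx.
- apply/existsP; exists [ffun=> false]; apply/forallP => w.
  by rewrite in_cons mem_enum !inE; case: (w == v).
Qed.

Lemma ex_function_of (v : G) : exists k, function_of_some v k.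
Proof. by exists #|G|.-1; exact: function_of_others. Qed.

(* [k = 0] is allowed: isolated and dominating vertices have value 0. *)
Definition vfun (v : G) : nat := ex_minn (ex_function_of v).

Lemma vfun_lt (v : G) : vfun v < #|G|.
Proof.
have G0 : 0 < #|G| by apply/card_gt0P; exists v.
rewrite /vfun; case: ex_minnP => k _ /(_ _ (function_of_others v)) le_k.
by rewrite (leq_ltn_trans le_k) // prednK.
Qed.

(* When [G] is nonempty the default value [#|G|] plays no role, by [vfun_lt]. *)
Definition min_vfun : nat := \big[minn/#|G|]_(v : G) vfun v.
End Functionality.

Definition functionality (G : sgraph) : nat :=
  \max_(S : {set G} | S != set0) min_vfun (induced S).

Section RandomGraph.
Variable n : nat.

Definition pairs : {set {set 'I_n}} := [set e : {set 'I_n} | #|e| == 2].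

Section EdgeGraph.
Variable E : {set {set 'I_n}}.

Definition edge_adj : rel 'I_n := fun x y => (x != y) && ([set x; y] \in E).

Lemma edge_adj_sym : symmetric edge_adj.
Proof. by move=> x y; rewrite /edge_adj eq_sym setUC. Qed.

Lemma edge_adj_irrefl : irreflexive edge_adj.
Proof. by move=> x; rewrite /edge_adj eqxx. Qed.

Definition edge_graph : sgraph := SGraph edge_adj_sym edge_adj_irrefl.
End EdgeGraph.

Local Open Scope ring_scope.
Variables (R : realType) (p : R).

Definition Gnp_weight (E : {set {set 'I_n}}) : R :=
  \prod_(e in pairs) (if e \in E then p else 1 - p).

(* The probability that G(n, p) satisfies [A]: each graph on ['I_n] is given
   by a unique edge set [E \subset pairs]. *)
Definition Gnp_prob (A : pred sgraph) : R :=
  \sum_(E : {set {set 'I_n}} | (E \subset pairs) && A (edge_graph E))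
     Gnp_weight E.

Lemma Gnp_prob_total : Gnp_prob predT = 1.
Proof.
pose F e : R := if e \in pairs then p else 0.
pose F' e : R := if e \in pairs then 1 - p else 1.
have <- : \prod_(e : {set 'I_n}) (F e + F' e) = 1.
  by apply: big1 => e _; rewrite /F /F'; case: ifP; rewrite ?add0r // addrC subrK.
rewrite bigA_distr /Gnp_prob big_mkcond; apply: eq_bigr => E _.
rewrite andbT; case: ifP => [/subsetP sE|/negbT /subsetPn[e eE eP]].
  rewrite /Gnp_weight big_mkcond; apply: eq_bigr => e _; rewrite /F /F'.
  by case: ifP => // eP; case: ifP => // /sE; rewrite eP.
by rewrite (bigD1 e) //= eE /F (negbTE eP) mul0r.
Qed.
End RandomGraph.

Definition log2 (R : realType) (x : R) : R := (ln x / ln 2)%R.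

(* Main.v *)
(**
Already the whole graph has large minimum functionality. Put mu = min(p, 1 - p)
and let a be the likelier state of a pair, of probability 1 - mu. If v is a
function f of u_1, ..., u_k, then for all outside vertices w whose pairs with
every u_i are in state a, the pair vw is in the same state f(a, ..., a). So,
with b the opposite state, no w has all its pairs with the u_i in state a and vw in
state b. Each w does so with probability at least mu (1 - mu)^k, independently
of the others. A union bound over v, the u_i and b, instead of over all 2^(2^k)
functions f, gives failure probability at most
2 n^(k+1) (1 - mu (1 - mu)^k)^(n - k - 1), which is small enough for
k = floor((log n) / 4).
*)

Require Import Defs.
From mathcomp Require Import all_boot all_order all_algebra.
From mathcomp Require Import reals sequences exp.
From mathcomp Require Import lra zify.

Import Order.TTheory GRing.Theory Num.Theory.
Local Open Scope ring_scope.

(** * What small functionality forces on the whole graph *)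

Lemma min_vfun_attained (G : sgraph) :
  (0 < #|G|)%N -> exists v : G, (vfun v <= min_vfun G)%N.
Proof.
case/card_gt0P=> v0 _; pose v := [arg min_(i < v0) vfun i].
have v_min (i : G) : (vfun v <= vfun i)%N.
  by rewrite /v; case: arg_minnP => // j _; exact.
exists v; rewrite /min_vfun; elim/big_ind: _ => [|x y le_x le_y|i _].
- exact: ltnW (vfun_lt v).
- by rewrite leq_min le_x.
- exact: v_min.
Qed.

(* The tuple [u] of [is_function_of] is padded with copies of [v] up to length
   [k], hence the condition [x != v]. *)
Lemma functionality_le (G : sgraph) (k : nat) :
  (0 < #|G|)%N -> (functionality G <= k)%N ->
  exists v : G, exists s : k.-tuple G, forall a : bool, exists b : bool,
    forall w : G, w \notin v :: s ->
      (forall x, x \in s -> x != v -> adj w x = a) -> adj v w = b.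
Proof.
move=> G_gt0 fun_le; pose H := induced [set: G].
have setT_neq0 : [set: G] != set0 by rewrite -card_gt0 cardsT.
have H_gt0 : (0 < #|H|)%N.
  by case/card_gt0P: G_gt0 => x _; apply/card_gt0P; exists (Sub x (in_setT x)).
have [v vfun_v] := min_vfun_attained _ H_gt0.
have {}vfun_v : (vfun v <= k)%N.
  apply: leq_trans vfun_v (leq_trans _ fun_le).
  exact: (@leq_bigmax_cond _ (fun S => S != set0)
            (fun S : {set G} => min_vfun (induced S))).
move: vfun_v; rewrite /vfun; case: ex_minnP => m /existsP[u /and3P[_ v_u]].
case/existsP=> f /forallP f_u _ le_mk.
have sz : size (map val u ++ nseq (k - m) (val v)) == k.
  by rewrite size_cat size_map size_tuple size_nseq subnKC.
(* [b] is the value of [f] at the constant vector [a], so only this one value of [f] matters. *)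
exists (val v), (Tuple sz) => a; exists (f [tuple of nseq m a]) => w.
rewrite inE mem_cat !negb_or => /and3P[w_v w_u _] w_s.
pose w' : H := Sub w (in_setT w).
have w'_vu : w' \notin v :: u.
  rewrite inE negb_or -val_eqE w_v.
  by apply: contra w_u => w'_u; apply/mapP; exists w'.
have /implyP/(_ w'_vu)/eqP f_w' := f_u w'.
rewrite -[adj _ _]/(@adj H v w') f_w'.
congr (f _); apply: val_inj => /=.
have all_a : all (pred1 a) [seq @adj H w' x | x <- u].
  apply/allP => _ /mapP[x x_u ->] /=; rewrite -(w_s (val x)) ?eqxx //.
    by rewrite mem_cat map_f.
  by apply: contra v_u => /eqP/val_inj <-.
by have /all_pred1P := all_a; rewrite size_map size_tuple.
Qed.

(** * Expectation and independence of edges *)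

Section RandomEdges.
Variables (n : nat) (R : realType) (p : R).
Implicit Types (S E : {set {set 'I_n}}) (T : pred {set 'I_n}).

Lemma Gnp_weight_ge0 E : 0 <= p <= 1 -> 0 <= Gnp_weight p E.
Proof.
case/andP=> p_ge0 p_le1.
by apply: prodr_ge0 => e _; case: ifP; rewrite ?subr_ge0.
Qed.

Definition Gnp_mean (X : {set {set 'I_n}} -> R) : R :=
  \sum_(E : {set {set 'I_n}} | E \subset pairs n) Gnp_weight p E * X E.

Definition edge_prob T (e : {set 'I_n}) : R := if T e then p else 1 - p.

(** The indicator that [E] and [T] coincide on [S], as a product so that it is multiplicative over
    disjoint unions of [S]. *)
Definition agree T S E : R := \prod_(e in S) ((e \in E) == T e)%:R.

(** Distributivity turns the sum over [E] into a product over all [e]: a pair in [S] contributes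
    only its prescribed state, another pair [p + (1 - p) = 1], and a set that is not a pair
    [0 + 1]. *)
Lemma Gnp_mean_agree T S :
  S \subset pairs n -> Gnp_mean (agree T S) = \prod_(e in S) edge_prob T e.
Proof.
move=> /subsetP sS; pose h e b : R := if e \in S then (b == T e)%:R else 1.
pose F e : R := (if e \in pairs n then p else 0) * h e true.
pose F' e : R := (if e \in pairs n then 1 - p else 1) * h e false.
transitivity (\prod_(e : {set 'I_n}) (F e + F' e)); last first.
  rewrite [RHS]big_mkcond; apply: eq_bigr => e _; rewrite /F /F' /h /edge_prob.
  case: (boolP (e \in S)) => [eS|_].
    by rewrite (sS _ eS); case: (T e);
      rewrite !eqxx /= !(mulr0, mulr1, addr0, add0r).
  by case: ifP; rewrite !mulr1 ?add0r // addrC subrK.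
rewrite bigA_distr /Gnp_mean big_mkcond; apply: eq_bigr => E _.
case: ifP => [/subsetP sE|/negbT /subsetPn[e eE eP]]; last first.
  by rewrite (bigD1 e) //= eE /F (negbTE eP) !mul0r.
rewrite /Gnp_weight /agree big_mkcond [X in _ * X]big_mkcond -big_split /=.
apply: eq_bigr => e _; rewrite /F /F' /h.
by case: (boolP (e \in E)) => // eE; rewrite (sE _ eE).
Qed.

(* Expanding the product over [W] reduces this to [Gnp_mean_agree]. *)
Lemma Gnp_mean_avoid (I : finType) (W : {set I}) (B : I -> {set {set 'I_n}}) T :
  (forall i, i \in W -> B i \subset pairs n) ->
  {in W &, forall i j, i != j -> [disjoint B i & B j]} ->
  Gnp_mean (fun E => \prod_(i in W) (1 - agree T (B i) E)) =
  \prod_(i in W) (1 - \prod_(e in B i) edge_prob T e).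
Proof.
move=> sB disjB.
(* Inclusion-exclusion, used both inside the expectation and on the right-hand side. *)
have expand (X : I -> R) : \prod_(i in W) (1 - X i) =
    \sum_(J in powerset W) (-1) ^+ #|J| * \prod_(i in J) X i.
  rewrite big_mkcond (eq_bigr (fun i => (if i \in W then - X i else 0) + 1)).
    rewrite bigA_distr [RHS]big_mkcond; apply: eq_bigr => J _.
    rewrite inE; case: ifP => [/subsetP sJ|/negbT/subsetPn[i iJ iW]].
      rewrite -big_mkcond /= -prodrN; apply: eq_bigr => i iJ.
      by rewrite sJ.
    by rewrite (bigD1 i) //= iJ (negbTE iW) mul0r.
  by move=> i _; case: ifP; rewrite ?add0r // addrC.
rewrite expand /Gnp_mean.
under eq_bigr => E _ do rewrite expand mulr_sumr.
rewrite exchange_big; apply: eq_bigr => J; rewrite inE => /subsetP sJ.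
under eq_bigr => E _ do rewrite mulrCA.
rewrite -mulr_sumr; congr (_ * _).
have disjJ : {in J &, forall i j, i != j -> [disjoint B i & B j]}.
  by move=> i j iJ jJ; apply: disjB; apply: sJ.
have sBJ : \bigcup_(i in J) B i \subset pairs n.
  by apply/bigcupsP => i /sJ/sB.
have bigJ (F : {set 'I_n} -> R) :
    \prod_(i in J) \prod_(e in B i) F e = \prod_(e in \bigcup_(i in J) B i) F e.
  (* Emptying the blocks outside [J] makes the family disjoint over all indices. *)
  have -> : \bigcup_(i in J) B i = \bigcup_i (if i \in J then B i else set0).
    by rewrite big_mkcond.
  rewrite partition_disjoint_bigcup => [|i j neq_ij].
    rewrite big_mkcond; apply: eq_bigr => i _.
    by case: ifP; rewrite ?big_set0.
  by do 2?case: ifP => ?; rewrite -?setI_eq0 ?setI0 ?set0I // setI_eq0 disjJ.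
rewrite bigJ -(Gnp_mean_agree _ _ sBJ); apply: eq_bigr => E _.
by rewrite /agree bigJ.
Qed.

Lemma agree_neq0 T S E :
  agree T S E != 0 -> forall e, e \in S -> (e \in E) = T e.
Proof.
move=> /prodf_neq0 agreeE e eS; apply/eqP.
by have := agreeE e eS; rewrite pnatr_eq0 eqb0 negbK.
Qed.

Lemma agree_itv T S E : 0 <= agree T S E <= 1.
Proof.
rewrite prodr_ge0 => [|e _]; last exact: ler0n.
by apply: prodr_ile1 => e _; rewrite ler0n lern1 leq_b1.
Qed.

(** * Forbidden stars and the union bound *)

Definition rest (v : 'I_n) (s : seq 'I_n) : {set 'I_n} := [set x in s] :\ v.

Definition star (v : 'I_n) (s : seq 'I_n) (w : 'I_n) : {set {set 'I_n}} :=
  [set [set w; x] | x in v |: rest v s].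

(** In the star of an outside vertex [w], the test [v \in e] singles out the pair [wv]. *)
Definition star_state (v : 'I_n) (a b : bool) : pred {set 'I_n} :=
  fun e => if v \in e then b else a.

Definition no_star (v : 'I_n) (s : seq 'I_n) (a b : bool) E : R :=
  \prod_(w in ~: (v |: rest v s)) (1 - agree (star_state v a b) (star v s w) E).

Lemma no_star_ge0 v s a b E : 0 <= no_star v s a b E.
Proof.
apply: prodr_ge0 => w _; rewrite subr_ge0.
by case/andP: (agree_itv (star_state v a b) (star v s w) E).
Qed.

(** [b] is the opposite of the state that [functionality_le] forces on [wv], so a star in the
    prescribed state would be a contradiction. *)
Lemma functionality_no_star E (k : nat) (a : bool) :
  (0 < n)%N -> (functionality (edge_graph E) <= k)%N ->
  exists v : 'I_n, exists s : k.-tuple 'I_n, exists b : bool,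
    no_star v s a b E = 1.
Proof.
move=> n_gt0 /functionality_le; rewrite card_ord => /(_ n_gt0)[v [s /(_ a)]].
case=> b vs_b; exists v, s, (~~ b); apply: big1 => w; rewrite inE => w_vs.
suff -> : agree (star_state v a (~~ b)) (star v s w) E = 0 by rewrite subr0.
apply/eqP/contraT => /agree_neq0 agree_w.
have w_v : w != v by apply: contraNneq w_vs => ->; rewrite setU11.
have w_s : w \notin s.
  by apply: contra w_vs => w_s; rewrite !inE w_s w_v orbT.
have : adj (s := edge_graph E) v w = b.
  apply: vs_b => [|x x_s x_v]; first by rewrite inE negb_or w_v w_s.
  rewrite /= /edge_adj agree_w.
    rewrite /star_state !inE !(eq_sym v) (negbTE w_v) (negbTE x_v) /=.
    by case: eqP => // wx; rewrite -wx (negbTE w_s) in x_s.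
  by apply/imsetP; exists x; rewrite // !inE x_s x_v orbT.
rewrite /= /edge_adj eq_sym w_v /= setUC agree_w.
  by rewrite /star_state !inE eqxx orbT; case: b {vs_b agree_w}.
by apply/imsetP; exists v; rewrite // setU11.
Qed.

(** Stars of distinct outside vertices share no pair, so [Gnp_mean_avoid] applies, and at least
    [n - k.+1] vertices are outside. *)
Lemma Gnp_mean_no_star (v : 'I_n) (k : nat) (s : k.-tuple 'I_n) (a b : bool)
    (mu : R) :
  0 <= mu <= 1 -> (if a then p else 1 - p) = 1 - mu -> mu <= p <= 1 - mu ->
  Gnp_mean (no_star v s a b) <= (1 - mu * (1 - mu) ^+ k) ^+ (n - k.+1).
Proof.
move=> /andP[mu_ge0 mu_le1] q_a /andP[mu_p p_mu].
have nu_ge0 : 0 <= 1 - mu by rewrite subr_ge0.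
have nu_le1 : 1 - mu <= 1 by rewrite gerBl.
have card_rest : (#|rest v s| <= k)%N.
  apply: leq_trans (subset_leq_card (subsetDl _ _)) _.
  by rewrite cardsE -{2}(size_tuple s) card_size.
have v_rest : v \notin rest v s by rewrite !inE eqxx.
rewrite Gnp_mean_avoid => [|w w_W|w w' w_W w'_W neq_w]; last 2 first.
- apply/subsetP => _ /imsetP[x x_vs ->]; rewrite inE cards2.
  by case: (w =P x) => // wx; move: w_W; rewrite wx inE x_vs.
- rewrite disjoint_subset; apply/subsetP => _ /imsetP[x x_vs ->].
  apply/negP => /imsetP[y y_vs wx_wy].
  have : w \in [set w'; y] by rewrite -wx_wy !inE eqxx.
  rewrite !inE (negbTE neq_w) /= => /eqP wy.
  by move: w_W; rewrite wy inE y_vs.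
have delta_ge0 : 0 <= mu * (1 - mu) ^+ k by rewrite mulr_ge0 ?exprn_ge0.
have delta_le1 : mu * (1 - mu) ^+ k <= 1.
  by rewrite mulr_ile1 ?exprn_ge0 ?exprn_ile1.
have star_prob w : w \in ~: (v |: rest v s) ->
    \prod_(e in star v s w) edge_prob (star_state v a b) e =
    (if b then p else 1 - p) * (1 - mu) ^+ #|rest v s|.
  rewrite inE => w_vs; rewrite big_imset => [|x y x_vs y_vs wx_wy] /=.
    rewrite big_setU1 //= /edge_prob /star_state !inE eqxx orbT; congr (_ * _).
    rewrite -[RHS]prodr_const; apply: eq_bigr => x x_s.
    suff -> : v \in [set w; x] = false by [].
    apply/negP; rewrite !inE => /orP[] /eqP v_wx.
      by move: w_vs; rewrite v_wx setU11.
    by move: x_s; rewrite -v_wx (negbTE v_rest).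
  have : x \in [set w; y] by rewrite -wx_wy !inE eqxx orbT.
  by rewrite !inE => /orP[] /eqP // xw; move: w_vs; rewrite -xw x_vs.
apply: (@le_trans _ _
  (\prod_(w in ~: (v |: rest v s)) (1 - mu * (1 - mu) ^+ k))).
  apply: ler_prod => w w_W; rewrite star_prob //.
  have q_b : mu <= (if b then p else 1 - p) <= 1.
    by case: (b); rewrite ?mu_p /=; lra.
  case/andP: q_b => q_b1 q_b2; have q_b0 := le_trans mu_ge0 q_b1.
  rewrite subr_ge0 mulr_ile1 ?exprn_ge0 ?exprn_ile1 ?q_b0 //=.
  (* [s] may repeat entries or contain [v]; then [rest v s] has fewer than [k] elements, which only
     raises the power of [1 - mu]. *)
  by rewrite lerD2l lerN2 ler_pM ?exprn_ge0 // ler_wiXn2l.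
rewrite prodr_const ler_wiXn2l ?subr_ge0 ?gerBl //.
rewrite cardsCs setCK card_ord leq_sub2l //.
by rewrite cardsU1 v_rest.
Qed.

Lemma Gnp_prob_functionality_gt (k : nat) (mu : R) (A : pred sgraph) :
  (0 < n)%N -> 0 <= mu <= 1 / 2 -> mu <= p <= 1 - mu -> mu = p \/ mu = 1 - p ->
  (forall G, ~~ A G -> (functionality G <= k)%N) ->
  1 - 2 * n%:R ^+ k.+1 * (1 - mu * (1 - mu) ^+ k) ^+ (n - k.+1)
    <= Gnp_prob n p A.
Proof.
move=> n_gt0 /andP[mu_ge0 mu_le] mu_p mu_eq notA.
have p01 : 0 <= p <= 1 by lra.
have mu01 : 0 <= mu <= 1 by lra.
(* [a] is fixed by [p], so the union bound runs over [v], [s] and [b] only. *)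
have [a q_a] : exists a : bool, (if a then p else 1 - p) = 1 - mu.
  by case: mu_eq => ->; [exists false | exists true; rewrite subKr].
pose I := ('I_n * k.-tuple 'I_n * bool)%type.
pose X (i : I) := no_star i.1.1 i.1.2 a i.2.
set delta := mu * (1 - mu) ^+ k.
have split : Gnp_prob n p A + \sum_(E : {set {set 'I_n}} |
    (E \subset pairs n) && ~~ A (edge_graph E)) Gnp_weight p E = 1.
  rewrite -(Gnp_prob_total n p) /Gnp_prob.
  rewrite [RHS](bigID (fun E => A (edge_graph E))) /=.
  by congr (_ + _); apply: eq_bigl => E; rewrite andbT.
rewrite lerBlDr -{1}split lerD2l.
have : \sum_(i : I) Gnp_mean (X i) <=
    2 * n%:R ^+ k.+1 * (1 - delta) ^+ (n - k.+1).
  apply: (@le_trans _ _ (\sum_(i : I) (1 - delta) ^+ (n - k.+1))).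
    by apply: ler_sum => i _; apply: Gnp_mean_no_star.
  rewrite sumr_const !card_prod card_ord card_tuple card_bool card_ord.
  by rewrite -[X in X <= _]mulr_natl -expnS natrM natrX [_ * 2]mulrC.
apply: le_trans; rewrite /Gnp_mean exchange_big /=.
rewrite [X in _ <= X](bigID (fun E => A (edge_graph E))) /=.
rewrite -[X in X <= _]add0r lerD //.
  apply: sumr_ge0 => E _; apply: sumr_ge0 => i _.
  by rewrite mulr_ge0 ?Gnp_weight_ge0 ?no_star_ge0.
(* For each failing [E] some indicator [X i] equals 1, and the others are nonnegative. *)
apply: ler_sum => E /andP[_ /notA fun_le].
have [v [s [b X1]]] := functionality_no_star _ _ a n_gt0 fun_le.
rewrite (bigD1 (v, s, b)) //= {1}/X /= X1 mulr1 lerDl.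
by apply: sumr_ge0 => i _; rewrite mulr_ge0 ?Gnp_weight_ge0 ?no_star_ge0.
Qed.

End RandomEdges.

(** * Numerical estimates *)

Lemma bernoulli (R : realFieldType) (x : R) (k : nat) :
  0 <= x <= 1 -> 1 - k%:R * x <= (1 - x) ^+ k.
Proof.
move=> x01; elim: k => [|k IHk]; first by rewrite mul0r subr0.
apply: (@le_trans _ _ ((1 - x) * (1 - k%:R * x))).
  have k_ge0 : 0 <= k%:R * x ^+ 2 by rewrite mulr_ge0 ?sqr_ge0.
  by rewrite -natr1; lra.
by rewrite exprS ler_wpM2l //; lra.
Qed.

(** Settles the case of large [mu] in [delta_lower_bound]. It fails at [k = 4], whence the threshold
    5. *)
Lemma cubic_le_exp8 (k : nat) : (5 <= k)%N -> (96 * k * k.+1 ^ 2 <= 8 ^ k)%N.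
Proof.
elim: k => // k IHk; rewrite leq_eqVlt => /predU1P[<- //|k_ge5].
by have := IHk k_ge5; rewrite [(8 ^ k.+1)%N]expnS; nia.
Qed.

Lemma linear_le_exp16 (k : nat) : (1 <= k)%N -> (4 * k.+1 <= 16 ^ k)%N.
Proof.
elim: k => // k IHk _; case: k IHk => // k /(_ isT).
by rewrite [(16 ^ k.+2)%N]expnS; lia.
Qed.

Section Estimates.
Variables (R : realType) (n k : nat).
Hypothesis n_k : (16 ^ k <= n < 16 ^ k.+1)%N.
Let L : R := log2 n%:R.

Lemma ln2_gt0 : 0 < ln 2 :> R.
Proof. by rewrite ln_gt0 // ltr1n. Qed.

Lemma ln2_le1 : ln 2 <= 1 :> R.
Proof. by have := @le_ln1Dx R 1; rewrite -[1 + 1]/(2 : R); apply; lra. Qed.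

Lemma n_pos : 0 < n%:R :> R.
Proof.
rewrite ltr0n; case/andP: n_k => n_ge _.
by apply: leq_trans n_ge; rewrite expn_gt0.
Qed.

Lemma log2_bounds : 4 * k%:R <= L < 4 * k.+1%:R.
Proof.
have ln16 (j : nat) : ln ((16 ^ j)%:R : R) = 4 * j%:R * ln 2.
  have -> : (16 ^ j = 2 ^ (4 * j))%N by rewrite expnM.
  by rewrite natrX lnXn ?ltr0n // -[LHS]mulr_natl natrM.
case/andP: n_k => n_ge n_lt; rewrite /L /log2.
rewrite ler_pdivlMr ?ltr_pdivrMr ?ln2_gt0 //.
rewrite -!ln16 ler_ln ?ltr_ln ?posrE ?n_pos ?ltr0n ?expn_gt0 //.
by rewrite ler_nat ltr_nat n_ge.
Qed.

(* For small [mu] Bernoulli gives [(1 - mu)^k >= 2/3]; otherwise [mu > 1 / (3k)]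
   and the crude bound [(1 - mu)^k >= 2^-k >= n^(-1/4)] suffices. *)
Lemma delta_lower_bound (mu : R) : (5 <= k)%N ->
  3 * L ^+ 2 / n%:R <= mu -> 0 <= mu <= 1 / 2 ->
  2 * L ^+ 2 <= mu * (1 - mu) ^+ k * n%:R.
Proof.
move=> k_ge5 mu_L mu_le; have n_gt0 := n_pos.
have k_gt0 : 0 < k%:R :> R by rewrite ltr0n; lia.
rewrite ler_pdivrMr // in mu_L.
have [k_mu|k_mu] := lerP (k%:R * mu) (1 / 3).
  have : 1 - k%:R * mu <= (1 - mu) ^+ k by apply: bernoulli; lra.
  have := sqr_ge0 L; nra.
have pow_half : (1 / 2) ^+ k <= (1 - mu) ^+ k.
  by apply: lerXn2r; rewrite ?nnegrE; lra.
have n_ge : 16 ^+ k <= n%:R :> R.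
  by rewrite -natrX ler_nat; case/andP: n_k.
have cubic : 96 * k%:R * k.+1%:R ^+ 2 <= 8 ^+ k :> R.
  by rewrite -!natrX -!natrM ler_nat cubic_le_exp8.
have L2 : L ^+ 2 <= (4 * k.+1%:R) ^+ 2.
  have /andP[L_ge L_lt] := log2_bounds; apply: lerXn2r; rewrite ?nnegrE; lra.
have exp8 : 8 ^+ k <= (1 - mu) ^+ k * n%:R.
  have -> : 8 ^+ k = (1 / 2) ^+ k * 16 ^+ k :> R.
    by rewrite -exprMn; congr (_ ^+ _); lra.
  by apply: ler_pM => //; rewrite exprn_ge0 //; lra.
have : 1 / (3 * k%:R) <= mu by rewrite ler_pdivrMr ?mulr_gt0 //; lra.
have : 8 ^+ k * mu <= mu * (1 - mu) ^+ k * n%:R.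
  by rewrite -mulrA mulrC ler_wpM2l //; lra.
move=> le1 le2; apply: le_trans le1.
(* [mu >= 1 / (3k)] cancels the factor [3k] of [96k], leaving [32 (k+1)^2], which is at least
   [2 L^2] since [L < 4 (k+1)]. *)
apply: (@le_trans _ _ (96 * k%:R * k.+1%:R ^+ 2 * mu)); last first.
  by rewrite ler_wpM2r //; lra.
apply: (@le_trans _ _ (32 * k.+1%:R ^+ 2)); first lra.
have := sqr_ge0 (k.+1%:R : R); nra.
Qed.

(** Compare exponents, with [n = exp (L ln 2)] and [1 - delta <= exp (- delta)]. From
    [delta n >= 2 L^2] and [n - k - 1 >= 3n/4] the decay is at least [3/2 L^2]; the factors [2],
    [n^(k+1)] and [n^L] cost [ln 2 (1 + (k+1) L + L^2)]. *)
Lemma union_bound_small (mu : R) : (5 <= k)%N ->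
  3 * L ^+ 2 / n%:R <= mu -> 0 <= mu <= 1 / 2 ->
  2 * n%:R ^+ k.+1 * (1 - mu * (1 - mu) ^+ k) ^+ (n - k.+1) <=
    1 / (n%:R `^ L).
Proof.
move=> k_ge5 mu_L mu_le; have n_gt0 := n_pos.
have delta_n := delta_lower_bound mu k_ge5 mu_L mu_le.
have delta_le1 : mu * (1 - mu) ^+ k <= 1.
  by rewrite mulr_ile1 ?exprn_ge0 ?exprn_ile1 //; lra.
move: (mu * _) delta_n delta_le1 => delta delta_n delta_le1.
have /andP[n_ge _] := n_k.
have n_k4 : (4 * k.+1 <= n)%N.
  by apply: leq_trans n_ge; apply: linear_le_exp16; lia.
have nk_ge : 3 / 4 * n%:R <= (n - k.+1)%:R :> R.
  rewrite natrB; last lia.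
  by have : (4 * k.+1)%:R <= n%:R :> R; [rewrite ler_nat | rewrite natrM; lra].
have ln_n : ln n%:R = L * ln 2 by rewrite divfK // gt_eqF // ln2_gt0.
have -> : n%:R `^ L = expR (L * (L * ln 2)).
  by rewrite /powR gt_eqF // ln_n.
have -> : n%:R ^+ k.+1 = expR (k.+1%:R * (L * ln 2)).
  by rewrite expRM_natl -ln_n lnK.
have exp_ln2 : 2 = expR (ln 2) :> R by rewrite lnK // posrE.
rewrite [X in X * _ * _ <= _]exp_ln2.
apply: (@le_trans _ _ (expR (ln 2) * expR (k.+1%:R * (L * ln 2))
                        * expR ((n - k.+1)%:R * - delta))).
  rewrite ler_pM2l ?mulr_gt0 ?expR_gt0 // expRM_natl.
  rewrite lerXn2r ?nnegrE ?expR_ge0 //; first lra.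
  exact: expR_ge1Dx.
rewrite -!expRD div1r -expRN ler_expR.
have /andP[L_ge _] := log2_bounds.
have k_ge5' : 5 <= k%:R :> R by rewrite (ler_nat _ 5).
have := ln2_gt0; have := ln2_le1; rewrite -natr1 => ln2_1 ln2_0.
(* As [L >= 4k], the term [(k+1) L] is at most [L^2 / 4 + L], and [L >= 20] absorbs the rest. *)
have exponent : 1 + (k%:R + 1) * L + L ^+ 2 <= 3 / 2 * L ^+ 2 by nra.
have : ln 2 * (1 + (k%:R + 1) * L + L ^+ 2) <= 3 / 2 * L ^+ 2.
  apply: le_trans exponent; rewrite ler_piMl //; nra.
have : 3 / 2 * L ^+ 2 <= (n - k.+1)%:R * delta by nra.
lra.
Qed.

End Estimates.

Theorem theorem3 (R : realType) :
  exists c : R, 0 < c /\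
    exists N : nat, forall n : nat, (N <= n)%N ->
      forall p : R,
        3 * log2 (n%:R : R) ^+ 2 / n%:R <= p ->
        p <= 1 - 3 * log2 (n%:R : R) ^+ 2 / n%:R ->
        1 - 1 / (n%:R `^ log2 (n%:R : R)) <=
          Gnp_prob n p (fun G => c * log2 (n%:R : R) <= (functionality G)%:R).
Proof.
(* With [k] the integer part of [L / 4], functionality below [L / 4 < k + 1] is at most [k]. *)
exists (1 / 4); split; first lra.
exists (16 ^ 5)%N => n n_ge p p_ge p_le.
pose k := trunc_log 16 n.
have n_gt0 : (0 < n)%N by apply: leq_trans n_ge; rewrite expn_gt0.
have n_k : (16 ^ k <= n < 16 ^ k.+1)%N := @trunc_log_bounds 16 n isT n_gt0.
have k_ge5 : (5 <= k)%N by rewrite /k trunc_log_max.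
have /andP[_ L_lt] := log2_bounds R n k n_k.
have mu0 : 0 <= 3 * log2 (n%:R : R) ^+ 2 / n%:R.
  by rewrite divr_ge0 ?ler0n // mulr_ge0 ?sqr_ge0 ?ler0n.
(* [mu] is the minimum of [p] and [1 - p]; the two bounds on [p] give the same lower bound in either
   case. *)
have [mu [mu_L mu_half mu_p mu_eq]] : exists mu : R,
    [/\ 3 * log2 (n%:R : R) ^+ 2 / n%:R <= mu, 0 <= mu <= 1 / 2,
        mu <= p <= 1 - mu & mu = p \/ mu = 1 - p].
  have [p_half|p_half] := lerP p (1 / 2).
    by exists p; split; [| lra | lra | left].
  by exists (1 - p); split; [lra | lra | lra | right].
apply: le_trans
  (Gnp_prob_functionality_gt n R p k mu _ n_gt0 mu_half mu_p mu_eq _).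
  by rewrite lerD2l lerN2; apply: union_bound_small.
move=> G; rewrite -ltNge => fun_lt.
rewrite -ltnS -(ltr_nat R); lra.
Qed.
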